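(* Fix $c>0$. For every $\alpha$ with $0<\alpha\le 4/15$ there exist infinitely many $n$ for which the following holds. There exist a connected, simple, unweighted, regular graph $G=([n],E)$ all of whose effective resistances are equal, and a distribution $\mathcal D$ on $\{0,1\}^{|E|}$ that is $k$-wise independent with marginals $1/2$ for $k=\lfloor 4/(3\alpha)\rfloor$, such that the expected degree of each vertex in a subgraph of $G$ sampled according to $\mathcal D$ equals $s=c\log n\cdot n^{\alpha_0}$ for some $\alpha_0\ge(1-2\alpha)\alpha$, and such that a subgraph of $G$ sampled according to $\mathcal D$ is disconnected with probability at least $1-2^{1-n}$. In particular, sampling according to $\mathcal D$ (with any reweighting of the surviving edges) fails, with probability at least $1-2^{1-n}$, to produce a graph whose Laplacian $\epsilon$-spectrally approximates the Laplacian of $G$, for every $\epsilon>0$.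
   Context: Sampling a subgraph according to $\mathcal D$ means drawing $x\sim\mathcal D$ and keeping exactly the edges $e$ with $x_e=1$. A distribution on $\{0,1\}^m$ is $k$-wise independent with marginals $p$ if its restriction to any at most $k$ coordinates is distributed as independent Bernoulli bits with means given by $p$. The effective resistance of $(a,b)$ is $(e_a-e_b)^\top L^+(e_a-e_b)$, with $L=D-A$ the Laplacian and $L^+$ its Moore–Penrose pseudoinverse. For symmetric PSD $A,B$, $A$ $\epsilon$-spectrally approximates $B$ if $(1-\epsilon)B\preceq A\preceq(1+\epsilon)B$.
   Formalization: The final clause is stated for 0 < ε < 1 rather than every ε > 0, since for ε ≥ 1 every unweighted subgraph trivially ε-spectrally approximates G; ''effective resistances are equal'' is read over the edges of G, and reweightings are nonnegative. *)

(* Defs.v *)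
From mathcomp Require Import all_boot all_order all_algebra.
From mathcomp Require Import boolp classical_sets reals exp.

Set Implicit Arguments.
Unset Strict Implicit.
Unset Printing Implicit Defensive.

Import Order.TTheory GRing.Theory Num.Theory.

Local Open Scope ring_scope.

Record dist (R : realType) (T : finType) := Dist {
  pmf :> T -> R;
  pmf_ge0 : forall x, 0 <= pmf x;
  pmf_sum1 : \sum_x pmf x = 1 }.

Definition Pr (R : realType) (T : finType) (D : dist R T) (P : T -> Prop) : R :=
  \sum_(x | `[< P x >]) D x.

Definition Ex (R : realType) (T : finType) (D : dist R T) (X : T -> R) : R :=
  \sum_x D x * X x.

Definition kwise_indep (R : realType) (I : finType) (k : nat) (p : I -> R)
    (D : dist R {ffun I -> bool}) : Prop :=
  forall (S : {set I}) (b : {ffun I -> bool}), (#|S| <= k)%N ->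
    Pr D (fun x => forall i, i \in S -> x i = b i) =
    \prod_(i in S) (if b i then p i else 1 - p i).

Record sgraph (n : nat) := SGraph {
  adj :> rel 'I_n;
  adj_sym : symmetric adj;
  adj_irr : irreflexive adj }.

Definition edges n (G : sgraph n) : {set {set 'I_n}} :=
  [set [set p.1; p.2] | p in [set p : 'I_n * 'I_n | G p.1 p.2]].

Definition edge n (G : sgraph n) : finType :=
  {A : {set 'I_n} | A \in edges G}.

Definition edge_set n (G : sgraph n) (e : edge G) : {set 'I_n} := sval e.

Definition degree n (G : sgraph n) (v : 'I_n) : nat := #|[set u | G v u]|.

Definition regular n (G : sgraph n) : Prop :=
  exists d : nat, forall v, degree G v = d.

Definition connected n (G : sgraph n) : Prop := forall u v, connect G u v.

Section Sample.
Variables (n : nat) (G : sgraph n) (x : {ffun edge G -> bool}).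

Definition sample_adj : rel 'I_n :=
  fun u v => [exists e : edge G, x e && (edge_set e == [set u; v])].

Lemma sample_adj_sym : symmetric sample_adj.
Proof. by move=> u v; rewrite /sample_adj finset.setUC. Qed.

Lemma sample_adj_irr : irreflexive sample_adj.
Proof.
move=> u; apply/negbTE/negP => /fintype.existsP[e /andP[_ /eqP E]].
have /imsetP[[a b]] : edge_set e \in edges G := svalP e.
rewrite inE E /= => Gab Eab.
have := finset.set21 a b; have := finset.set22 a b.
rewrite -Eab !inE !orbb => /eqP Eb /eqP Ea.
by move: Gab; rewrite Ea Eb (adj_irr G).
Qed.

Definition sample : sgraph n := SGraph sample_adj_sym sample_adj_irr.

End Sample.

(* [W] is a weighted adjacency matrix. *)
Definition laplacian (R : realType) n (W : 'M[R]_n) : 'M[R]_n :=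
  diag_mx (\row_i \sum_j W i j) - W.

Definition adjmx (R : realType) n (G : sgraph n) : 'M[R]_n :=
  \matrix_(i, j) (G i j)%:R.

(* At most one edge contributes to each entry; only surviving edges count. *)
Definition sample_adjmx (R : realType) n (G : sgraph n)
    (x : {ffun edge G -> bool}) (w : edge G -> R) : 'M[R]_n :=
  \matrix_(i, j) \sum_(e : edge G | x e && (edge_set e == [set i; j])) w e.

Definition penrose (R : realType) m n (A : 'M[R]_(m, n)) (X : 'M[R]_(n, m)) :
    Prop :=
  [/\ A *m X *m A = A, X *m A *m X = X,
      (A *m X)^T = A *m X & (X *m A)^T = X *m A].

Definition mpinv (R : realType) m n (A : 'M[R]_(m, n)) : 'M[R]_(n, m) :=
  xget 0 (penrose A).

Definition eff_res (R : realType) n (G : sgraph n) (a b : 'I_n) : R :=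
  let v : 'cV[R]_n := delta_mx a 0 - delta_mx b 0 in
  (v^T *m mpinv (laplacian (adjmx R G)) *m v) 0 0.

Definition psdmx (R : realType) n (A : 'M[R]_n) : Prop :=
  A^T = A /\ forall v : 'cV[R]_n, 0 <= (v^T *m A *m v) 0 0.

Definition loewner_le (R : realType) n (A B : 'M[R]_n) : Prop := psdmx (B - A).

(* For [1 <= eps] the lower bound is vacuous between Laplacians: every unweighted
   subgraph, even the empty one, then [eps]-approximates the whole graph. *)
Definition spectral_approx (R : realType) n (eps : R) (A B : 'M[R]_n) : Prop :=
  loewner_le ((1 - eps) *: B) A /\ loewner_le A ((1 + eps) *: B).

(* [mpinv] is well defined: the Penrose equations have exactly one solution. *)

Lemma penrose_uniq (R : realType) m n (A : 'M[R]_(m, n)) X Y :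
  penrose A X -> penrose A Y -> X = Y.
Proof.
move=> [X1 X2 X3 X4] [Y1 Y2 Y3 Y4].
have AXY : A *m X = A *m Y.
  rewrite -{1}Y1 -(mulmxA _ A X) -X3 -Y3 -trmx_mul.
  by rewrite mulmxA X1 Y3.
have XYA : X *m A = Y *m A.
  rewrite -{1}Y1 mulmxA mulmxA -(mulmxA _ Y A) -X4 -Y4 -trmx_mul.
  by rewrite -(mulmxA Y A) (mulmxA A X) X1 Y4.
by rewrite -X2 XYA -mulmxA AXY mulmxA Y2.
Qed.

Lemma gram_unit (R : realType) m n (A : 'M[R]_(m, n)) :
  row_free A -> A *m A^T \in unitmx.
Proof.
move=> fA; rewrite -row_free_unit -kermx_eq0; apply/eqP/row_matrixP => i.
rewrite row0; set v := row i _.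
have v0 : v *m (A *m A^T) = 0.
  by apply/sub_kermxP; rewrite row_sub.
have : v *m A = 0.
  have /matrixP/(_ 0 0) : (v *m A) *m (v *m A)^T = 0.
    by rewrite trmx_mul -mulmxA (mulmxA A) mulmxA v0 mul0mx.
  rewrite !mxE => /eqP; rewrite psumr_eq0 => [/allP S0|j _]; last first.
    by rewrite [X in _ * X]mxE -expr2 sqr_ge0.
  apply/rowP => j; have := S0 j (mem_index_enum _).
  by rewrite [X in _ * X]mxE -expr2 sqrf_eq0 [RHS]mxE => /eqP.
by move=> /eqP; rewrite mulmx_free_eq0 // => /eqP.
Qed.

Lemma penrose_ex (R : realType) m n (A : 'M[R]_(m, n)) :
  exists X, penrose A X.
Proof.
have [r [C [B [uC uB defA]]]] : exists r (C : 'M[R]_(m, r)) (B : 'M[R]_(r, n)),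
    [/\ C^T *m C \in unitmx, B *m B^T \in unitmx & A = C *m B].
  exists (\rank A), (col_base A), (row_base A); split.
  - rewrite -{2}(trmxK (col_base A)); apply: gram_unit.
    by rewrite /row_free mxrank_tr; exact: col_base_full.
  - by apply/gram_unit/row_base_free.
  - by rewrite mulmx_base.
pose P := B^T *m invmx (B *m B^T); pose Q := invmx (C^T *m C) *m C^T.
have BP : B *m P = 1%:M by rewrite mulmxA mulmxV.
have QC : Q *m C = 1%:M by rewrite -mulmxA mulVmx.
have AX : A *m (P *m Q) = C *m Q.
  by rewrite defA mulmxA -(mulmxA C) BP mulmx1.
have XA : (P *m Q) *m A = P *m B.
  by rewrite defA mulmxA -(mulmxA P) QC mulmx1.
exists (P *m Q); split; rewrite ?AX ?XA.
- by rewrite defA mulmxA -(mulmxA C) QC mulmx1.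
- by rewrite mulmxA -(mulmxA P) BP mulmx1.
- by rewrite /Q !trmx_mul trmxK trmx_inv trmx_mul trmxK mulmxA.
- by rewrite /P !trmx_mul trmxK trmx_inv trmx_mul trmxK mulmxA.
Qed.

Lemma mpinvP (R : realType) m n (A : 'M[R]_(m, n)) : penrose A (mpinv A).
Proof. by apply: (@xgetPex _ 0 (penrose A)); exact: penrose_ex. Qed.

(* Main.v *)
Require Import Defs.
From mathcomp Require Import all_boot all_order all_algebra.
From mathcomp Require Import boolp classical_sets reals exp.
From HB Require Import structures.
From mathcomp Require Import all_fingroup qpoly sequences ring lra zify.
From mathcomp Require Import fintype finset.
Import Order.TTheory GRing.Theory Num.Theory.
Local Open Scope ring_scope.

(** Colour the vertices of [G] black and white uniformly at random and keep the
    monochromatic edges. Unless all colours agree, the sample is disconnected and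
    the indicator of a colour class is in the kernel of every reweighted sample
    Laplacian. If [G] has girth greater than [k], any [k] edges form a forest, and
    flipping the colour of a leaf shows that the corresponding bits are independent
    and uniform.

    For [G] take the incidence graph of the left cosets of
    [U_true = {(1, x; 0, 1)}] and [U_false = {(1, 0; x X, 1)}], with [x] in [F_p],
    in the subgroup of [SL_2(F_p[X]/X^m)] that they generate. It is connected,
    [p]-regular, and the group is transitive on its edges, so all effective
    resistances across edges agree. A cycle of length [2 l] is a matrix [W] over
    [F_p[X]], a product of [2 l] alternating nontrivial factors, with [W = 1] modulo
    [X^m]. As [det W = 1], the trace of [W] is [2] modulo [X^(2 m)]; but it has degree
    exactly [l], so [2 m <= l]. Thus the girth is at least [4 m], with at most
    [2 p^(3 m - 1)] vertices. With [m = k / 4 + 1] and [k <= 4 / (3 alpha)] this gives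
    [3 m - 1 <= 1 / alpha + 2], and
    [(1 / alpha + 2) (1 - 2 alpha) alpha = 1 - 4 alpha^2 < 1] leaves room for the
    logarithm. *)

Set Implicit Arguments.
Unset Strict Implicit.
Unset Printing Implicit Defensive.

(** * Random two-colourings *)

Section Coloring.
Variables (R : realType) (n : nat) (G : sgraph n).
Implicit Types (y : {ffun 'I_n -> bool}) (e : edge G) (x : {ffun edge G -> bool}).

Lemma edgeP e : exists a b, [/\ G a b & edge_set e = [set a; b]].
Proof.
by rewrite /edge_set; case/imsetP: (svalP e) => -[a b]; rewrite inE => Gab ->; exists a, b.
Qed.

Lemma edge_ex a b : G a b -> exists e, edge_set e = [set a; b].
Proof.
move=> Gab; have E : [set a; b] \in edges G.
  by apply/imsetP; exists (a, b); rewrite ?inE.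
by exists (exist (fun A => A \in edges G) _ E).
Qed.

Lemma edge_set_inj : injective (@edge_set n G).
Proof. exact: val_inj. Qed.

Definition mono y : {ffun edge G -> bool} :=
  [ffun e => [forall a in edge_set e, forall b in edge_set e, y a == y b]].

Lemma monoE y e a b : edge_set e = [set a; b] -> mono y e = (y a == y b).
Proof.
move=> E; rewrite ffunE E; apply/idP/idP => [|/eqP yab].
  by move=> /forall_inP/(_ a (set21 _ _)) /forall_inP/(_ b (set22 _ _)).
apply/forall_inP => u /set2P Hu; apply/forall_inP => v /set2P Hv.
by case: Hu Hv => -> [] ->; rewrite ?yab.
Qed.

(** The pushforward under [mono] of the uniform distribution on the [2 ^ n] colourings. *)
Definition mono_pmf x : R := #|[set y | mono y == x]|%:R / 2 ^+ n.

Lemma sum_mono_pmf (P : pred {ffun edge G -> bool}) :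
  \sum_(x | P x) mono_pmf x = #|[set y | P (mono y)]|%:R / 2 ^+ n.
Proof.
rewrite -mulr_suml -natr_sum; congr (_%:R / _).
rewrite -sum1_card (partition_big mono P) /=; last by move=> y; rewrite inE.
apply: eq_bigr => x Px; rewrite -sum1_card; apply: eq_bigl => y.
by rewrite !inE; case: eqP => [->|]; rewrite ?Px ?andbF.
Qed.

Lemma mono_pmf_ge0 x : 0 <= mono_pmf x.
Proof. by rewrite divr_ge0 ?exprn_ge0. Qed.

Lemma mono_pmf_sum1 : \sum_x mono_pmf x = 1.
Proof.
rewrite (sum_mono_pmf predT) cardsT card_ffun card_bool card_ord natrX divff //.
by rewrite expf_neq0 // pnatr_eq0.
Qed.

Definition mono_dist : dist R {ffun edge G -> bool} :=
  Dist mono_pmf_ge0 mono_pmf_sum1.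

Lemma Pr_mono (P : {ffun edge G -> bool} -> Prop) :
  Pr mono_dist P = #|[set y | `[< P (mono y) >]]|%:R / 2 ^+ n.
Proof. exact: (sum_mono_pmf (fun x => `[< P x >])). Qed.

Definition flip (v : 'I_n) y : {ffun 'I_n -> bool} :=
  [ffun u => y u (+) (u == v)].

Lemma flipK v : involutive (flip v).
Proof. by move=> y; apply/ffunP => u; rewrite !ffunE addbK. Qed.

Lemma mono_flip v y e : mono (flip v y) e = mono y e (+) (v \in edge_set e).
Proof.
have [a [b [Gab E]]] := edgeP e; rewrite !(monoE _ E) !ffunE E !inE ![_ == v]eq_sym.
have : ~~ ((v == a) && (v == b)).
  by apply/negP => /andP[/eqP va /eqP vb]; move: Gab; rewrite -va -vb (adj_irr G).
by case: (v == a); case: (v == b); case: (y a); case: (y b).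
Qed.

(* Holds if the girth exceeds [k], since at most [k] edges then form a forest. *)
Definition leafy (k : nat) := forall S : {set edge G}, S != set0 -> (#|S| <= k)%N ->
  exists e v, [/\ e \in S, v \in edge_set e &
    forall e', e' \in S -> v \in edge_set e' -> e' = e].

(* Flipping the colour of a leaf flips only one of the observed bits. *)
Lemma card_mono k (S : {set edge G}) (b : {ffun edge G -> bool}) : leafy k ->
  (#|S| <= k)%N ->
  (#|[set y | [forall e in S, mono y e == b e]]| * 2 ^ #|S| = 2 ^ n)%N.
Proof.
move=> lk; have [m] := ubnP #|S|; elim: m S => // m IH S ltSm leSk.
have [->|S0] := eqVneq S set0.
  rewrite cards0 muln1 -[n in RHS]card_ord -card_bool -card_ffun -cardsT.
  congr #|pred_of_set _|; apply/setP => y; rewrite !inE.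
  by apply/forall_inP => e; rewrite inE.
have [e [v [eS ve uniq]]] := lk S S0 leSk.
pose A := [set y | [forall e' in S :\ e, mono y e' == b e']].
have cS : #|S| = #|S :\ e|.+1 by rewrite (cardsD1 e) eS.
have := IH (S :\ e); rewrite -cS => /(_ ltSm); rewrite -/A cS.
move/(_ (leq_trans _ leSk)); rewrite cS leqnSn => /(_ isT) <-.
rewrite expnS mulnA; congr (_ * _)%N.
rewrite -(cardsID [set y | mono y e == b e] A) muln2 -addnn.
have EI : [set y | [forall e' in S, mono y e' == b e']] =
          A :&: [set y | mono y e == b e].
  apply/setP => y; rewrite !inE; apply/forall_inP/andP => [H|[/forall_inP H He] e' e'S].
    by split; [apply/forall_inP => e' /setD1P[_ /H]|exact: H].
  by have [->//|ne] := eqVneq e' e; apply: H; rewrite !inE ne.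
rewrite EI; congr (_ + _)%N.
rewrite -(card_imset _ (inv_inj (flipK v))); congr #|pred_of_set _|; apply/setP => y.
have flA z : z \in A -> flip v z \in A.
  rewrite !inE => /forall_inP H; apply/forall_inP => e' /[dup] /setD1P[ne e'S] /H.
  rewrite mono_flip; case: (boolP (v \in _)) => [/(uniq _ e'S) E|_]; last by rewrite addbF.
  by rewrite E eqxx in ne.
apply/imsetP/idP => [[z /setIP[zA]]|].
  rewrite inE => /eqP ze ->; rewrite !inE mono_flip ve ze.
  have := flA _ zA; rewrite !inE => ->.
  by case: (b e).
case/setDP => yA; rewrite inE => ye.
exists (flip v y); last by rewrite flipK.
rewrite inE flA // inE mono_flip ve.
by move: ye; case: (mono y e); case: (b e).
Qed.

Lemma mono_kwise k : leafy k -> kwise_indep k (fun=> 1 / 2) mono_dist.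
Proof.
move=> lk S b leSk; rewrite Pr_mono.
have -> : \prod_(i in S) (if b i then 1 / 2 else 1 - 1 / 2) = (2 ^+ #|S|)^-1 :> R.
  rewrite -exprVn -prodr_const; apply: eq_bigr => i _.
  have -> : 1 - 1 / 2 = 1 / 2 :> R by lra.
  by rewrite if_same div1r.
have nz m : 2 ^+ m != 0 :> R by rewrite expf_neq0 // pnatr_eq0.
apply: (mulIf (nz #|S|)); rewrite mulVf // mulrAC; apply: (mulIf (nz n)).
rewrite divfK // mul1r -!natrX -natrM; congr _%:R.
rewrite -(card_mono b lk leSk); congr (_ * _)%N; apply: eq_card => y; rewrite !inE.
apply/asboolP/forall_inP => H e /H; first by move=> ->.
by move/eqP.
Qed.

Lemma sample_adjE x e a b : edge_set e = [set a; b] -> sample_adj x a b = x e.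
Proof.
move=> E; apply/existsP/idP => [[e' /andP[xe' /eqP E']]|xe].
  by rewrite -E in E'; rewrite -(edge_set_inj E').
by exists e; rewrite xe E eqxx.
Qed.

Lemma sub_sample x a b : sample_adj x a b -> G a b.
Proof.
case/existsP => e /andP[_ /eqP]; have [u [v [Guv ->]]] := edgeP e.
move=> E; have uab : u \in [set a; b] by rewrite -E set21.
have vab : v \in [set a; b] by rewrite -E set22.
by case/set2P: uab vab Guv => -> /set2P[] ->; rewrite ?(adj_irr G) // (adj_sym G).
Qed.

Lemma mono_sample y a b : sample_adj (mono y) a b -> y a = y b.
Proof. by case/existsP => e /andP[+ /eqP E]; rewrite (monoE _ E) => /eqP. Qed.

(** Linearity of expectation: independence of single edges lets each edge at [v] survive with
    probability one half. *)
Lemma mono_degree k (v : 'I_n) : leafy k -> (0 < k)%N ->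
  Ex mono_dist (fun x => (degree (sample x) v)%:R) = (degree G v)%:R / 2.
Proof.
move=> lk k0; rewrite /Ex.
under eq_bigr => x _ do rewrite /degree -sum1_card natr_sum mulr_sumr big_mkcond /=.
rewrite exchange_big /= /degree -sum1_card natr_sum mulr_suml [RHS]big_mkcond /=.
apply: eq_bigr => u _; rewrite !inE.
have [Gvu|nG] := boolP (G v u); last first.
  by apply: big1 => x _; rewrite inE; case: ifP => // /sub_sample; rewrite (negbTE nG).
have [e E] := edge_ex Gvu.
have := mono_kwise lk (S := [set e]) [ffun=> true]; rewrite cards1 big_set1 ffunE => /(_ k0) <-.
rewrite /Pr [RHS]big_mkcond; apply: eq_bigr => x _; rewrite inE (sample_adjE _ E) mulr1.
congr (if _ then _ else _); apply/idP/asboolP => [xe i|]; first by rewrite inE ffunE => /eqP ->.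
by move/(_ e (set11 _)); rewrite ffunE.
Qed.

Lemma card_const_coloring : (0 < n)%N ->
  #|[set y : {ffun 'I_n -> bool} | [forall a, forall b, y a == y b]]| = 2%N.
Proof.
move=> n0; pose v := Ordinal n0.
have inj : injective (fun t : bool => [ffun=> t] : {ffun 'I_n -> bool}).
  by move=> s t /ffunP/(_ v); rewrite !ffunE.
rewrite -[RHS]card_bool -(card_codom inj); apply: eq_card => y.
rewrite !inE; apply/forallP/codomP => [H|[t -> a]].
  by exists (y v); apply/ffunP => a; rewrite ffunE; apply/eqP; have /forallP := H a; exact.
by apply/forallP => b; rewrite !ffunE.
Qed.

(** Of the [2 ^ n] colourings, only the two constant ones can violate [P]. *)
Lemma Pr_mono_ge (P : {ffun edge G -> bool} -> Prop) : (0 < n)%N ->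
  (forall y, ~ P (mono y) -> forall a b, y a = y b) ->
  1 - 2 ^ (1 - n%:Z) <= Pr mono_dist P.
Proof.
move=> n0 H; rewrite Pr_mono.
have nz : 2 ^+ n != 0 :> R by rewrite expf_neq0 // pnatr_eq0.
rewrite ler_pdivlMr ?exprn_gt0 // mulrBl mul1r expfzDr ?pnatr_eq0 // -invr_expz.
rewrite -!exprnP expr1 divfK // lerBlDr -natrX -natrD ler_nat.
have -> : (2 ^ n)%N = #|[set: {ffun 'I_n -> bool}]|.
  by rewrite cardsT card_ffun card_bool card_ord.
rewrite -(card_const_coloring n0).
apply: leq_trans (leq_card_setU _ _); apply: subset_leq_card.
apply/subsetP => y _; rewrite !inE; have [//|/asboolP/H yc] := boolP `[< P (mono y) >].
by apply/forallP => a; apply/forallP => b; apply/eqP.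
Qed.

Lemma connected_const (T : eqType) (f : 'I_n -> T) :
  connected G -> (forall a b, G a b -> f a = f b) -> forall a b, f a = f b.
Proof.
move=> cG fG a b; have /connectP[p] := cG a b.
elim: p a => [|u p IH] a /= => [_ ->//|/andP[/fG -> /IH]]; exact.
Qed.

End Coloring.

(** * Failure of spectral approximation *)

Section Laplacian.
Variables (R : realType) (n : nat).

Lemma laplacian_mulE (W : 'M[R]_n) (v : 'cV[R]_n) i :
  (laplacian W *m v) i 0 = \sum_j W i j * (v i 0 - v j 0).
Proof.
rewrite /laplacian mulmxBl mul_diag_mx !mxE mulr_suml -sumrB.
by apply: eq_bigr => j _; rewrite mulrBr.
Qed.

Lemma quad_form_colE (A : 'M[R]_n) (v : 'cV[R]_n) :
  (v^T *m A *m v) 0 0 = \sum_i v i 0 * (A *m v) i 0.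
Proof. by rewrite -mulmxA mxE; apply: eq_bigr => i _; rewrite mxE. Qed.

Variable G : sgraph n.

(** The sample Laplacian kills the indicator [v] of a colour class. As [eps < 1], the lower bound
    then forces the quadratic form of the Laplacian of [G] to be at most [0] at [v], where it counts
    the bichromatic edges. So there are none, and connectedness does the rest. *)
Lemma mono_not_spectral_approx (y : {ffun 'I_n -> bool}) (w : edge G -> R) (eps : R) :
  connected G -> eps < 1 ->
  spectral_approx eps (laplacian (sample_adjmx (mono G y) w))
    (laplacian (adjmx R G)) ->
  forall a b, y a = y b.
Proof.
move=> cG eps1 [[_ low] _]; pose v : 'cV[R]_n := \col_i (y i)%:R.
have v0 : laplacian (sample_adjmx (mono G y) w) *m v = 0.
  apply/colP => i; rewrite laplacian_mulE [RHS]mxE; apply: big1 => j _.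
  have [yij|nyij] := eqVneq (y i) (y j); first by rewrite !mxE yij subrr mulr0.
  rewrite mxE big_pred0 ?mul0r // => e; apply/negP => /andP[+ /eqP E].
  by rewrite (monoE _ E) (negbTE nyij).
have quad : \sum_i v i 0 * (laplacian (adjmx R G) *m v) i 0 <= 0.
  have := low v; rewrite mulmxBr mulmxBl mxE -mulmxA v0 mulmx0 mxE add0r.
  rewrite [X in 0 <= X]mxE -scalemxAr -scalemxAl [X in - X]mxE quad_form_colE oppr_ge0.
  by rewrite pmulr_rle0 // subr_gt0.
(* Since [v] is 0/1-valued, the terms are nonnegative one by one; an edge from colour [true] to
   colour [false] contributes [1]. *)
have t_ge0 i j : 0 <= v i 0 * (adjmx R G i j * (v i 0 - v j 0)).
  by rewrite !mxE; do 2!case: (y _); case: (G i j); rewrite ?(mul0r, mulr0, subrr, subr0, mul1r).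
have row_ge0 i : 0 <= v i 0 * (laplacian (adjmx R G) *m v) i 0.
  by rewrite laplacian_mulE mulr_sumr; apply: sumr_ge0 => j _; exact: t_ge0.
have imp a b : G a b -> y a -> y b.
  move=> Gab ya; apply: contraT => nyb; move: quad; rewrite leNgt => /negP[].
  rewrite (bigD1 a) //= ltr_pwDl ?sumr_ge0 // laplacian_mulE mulr_sumr.
  rewrite (bigD1 b) //= ltr_pwDl ?sumr_ge0 //.
  by rewrite !mxE ya (negbTE nyb) Gab subr0 !mulr1.
apply: (connected_const cG) => a b Gab; apply/idP/idP; apply: imp => //.
by rewrite (adj_sym G).
Qed.
End Laplacian.

(** * Coset graphs *)

Section EffectiveResistance.
Variables (R : realType) (n : nat).

(** Conjugation by a permutation matrix preserves the Penrose equations, whose solution is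
    unique. *)
Lemma mpinv_perm (A : 'M[R]_n) (s : 'S_n) :
  (forall i j, A (s i) (s j) = A i j) ->
  forall i j, mpinv A (s i) (s j) = mpinv A i j.
Proof.
move=> As; pose P : 'M[R]_n := perm_mx s.
have conjE (B : 'M[R]_n) i j : (P *m B *m P^T) i j = B (s i) (s j).
  by rewrite tr_perm_mx -row_permE -col_permE !mxE.
have PP : P^T *m P = 1%:M by rewrite tr_perm_mx -perm_mxM mulVg perm_mx1.
have conjM (B C : 'M[R]_n) : (P *m B *m P^T) *m (P *m C *m P^T) = P *m (B *m C) *m P^T.
  by rewrite !mulmxA -(mulmxA (P *m B)) PP mulmx1.
have conjA : P *m A *m P^T = A by apply/matrixP => i j; rewrite conjE As.
have [X1 X2 X3 X4] := mpinvP A; set X := mpinv A in X1 X2 X3 X4 *.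
have conjT (B : 'M[R]_n) : (P *m B *m P^T)^T = P *m B^T *m P^T.
  by rewrite !trmx_mul trmxK mulmxA.
suff XE : P *m X *m P^T = X by move=> i j; rewrite -[in RHS]XE conjE.
apply: (penrose_uniq (A := A)) => //; split.
- by rewrite -[in LHS]conjA !conjM X1 conjA.
- by rewrite -conjA !conjM X2.
- by rewrite -conjA conjM conjT X3.
- by rewrite -conjA conjM conjT X4.
Qed.

Lemma eff_resE (G : sgraph n) a b (X := mpinv (laplacian (adjmx R G))) :
  eff_res R G a b = X a a + X b b - (X a b + X b a).
Proof.
rewrite /eff_res -/X [(_ - _)^T]raddfB /= !trmx_delta mulmxBl -!rowE mulmxBr !mulmxBl -!colE.
by rewrite !mxE; ring.
Qed.

Lemma eff_res_sym (G : sgraph n) a b : eff_res R G a b = eff_res R G b a.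
Proof. by rewrite !eff_resE [X in X - _]addrC [X in _ - X]addrC. Qed.

Lemma eff_res_perm (G : sgraph n) (s : 'S_n) a b :
  (forall i j, G (s i) (s j) = G i j) -> eff_res R G (s a) (s b) = eff_res R G a b.
Proof.
move=> Gs; rewrite !eff_resE.
have /mpinv_perm H : forall i j,
    laplacian (adjmx R G) (s i) (s j) = laplacian (adjmx R G) i j; last by rewrite !H.
move=> i j; rewrite !mxE Gs.
rewrite (inj_eq perm_inj) (reindex_inj (@perm_inj _ s)); congr (_ *+ _ - _).
by apply: eq_bigr => u _; rewrite !mxE Gs.
Qed.

End EffectiveResistance.

(** * The incidence graph of the cosets of two subgroups *)

Section CosetGraph.
Local Open Scope group_scope.
Variables (gT : finGroupType) (U : bool -> {group gT}).
Hypothesis TI_U : U false :&: U true = 1.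

Let G : {group gT} := (U false <*> U true)%G.
Implicit Types (b : bool) (g h u : gT).

Lemma sub_join_bool b : U b \subset G.
Proof. by case: b; rewrite ?joing_subl ?joing_subr. Qed.

(** The tag keeps the two sides disjoint. *)
Definition cosets_bool : {set bool * {set gT}} :=
  [set p | p.2 \in lcosets (U p.1) G].

Definition ncosets : nat := #|cosets_bool|.

Lemma coset_in b g : g \in G -> (b, g *: U b) \in cosets_bool.
Proof. by move=> gG; rewrite inE; apply/lcosetsP; exists g. Qed.

Definition vx b g : 'I_ncosets := enum_rank_in (coset_in false (group1 G)) (b, g *: U b).

Lemma enum_val_vx b g : g \in G -> enum_val (vx b g) = (b, g *: U b).
Proof. by move=> gG; rewrite enum_rankK_in ?coset_in. Qed.

Lemma vx_surj i : exists b g, g \in G /\ i = vx b g.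
Proof.
have := enum_valP i; rewrite inE => /lcosetsP[g gG E].
by exists (enum_val i).1, g; split=> //; rewrite /vx -E -surjective_pairing enum_valK_in.
Qed.

Lemma vx_eq b b' g h : g \in G -> h \in G ->
  (vx b g == vx b' h) = (b == b') && (g^-1 * h \in U b).
Proof.
move=> gG hG; rewrite -(inj_eq enum_val_inj) !enum_val_vx // xpair_eqE.
case: eqP => //= <-; rewrite -mem_lcoset; apply/eqP/idP => [->|]; first exact: lcoset_refl.
by move/lcoset_eqP->.
Qed.

Lemma vx_mulr b g u : g \in G -> u \in U b -> vx b (g * u) = vx b g.
Proof.
move=> gG uU; have guG := groupM gG (subsetP (sub_join_bool b) _ uU).
by apply/eqP; rewrite vx_eq // eqxx invMg -mulgA mulVg mulg1 groupV.
Qed.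

Lemma ncosets_card q : (forall b, #|U b| = q) -> (ncosets * q = 2 * #|G|)%N.
Proof.
move=> cU.
have -> : ncosets = (\sum_b #|lcosets (U b) G|)%N.
  rewrite /ncosets -sum1_card (partition_big fst predT) //=; apply: eq_bigr => b _.
  rewrite -sum1_card (reindex_onto (pair b) snd) /=; last first.
    by case=> b' C /andP[_ /eqP /= ->].
  by apply: eq_bigl => C; rewrite inE /= !eqxx !andbT.
rewrite big_distrl -[2%N]card_bool -sum_nat_const /=; apply: eq_bigr => b _.
by rewrite card_lcosets -(cU b) mulnC Lagrange ?sub_join_bool.
Qed.

(** Edges come from group elements: [g] joins the two cosets containing it. *)
Definition coset_adj : rel 'I_ncosets := fun i j =>
  [exists g in G, exists b, (i == vx b g) && (j == vx (~~ b) g)].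

Lemma coset_adjP i j :
  reflect (exists b g, [/\ g \in G, i = vx b g & j = vx (~~ b) g]) (coset_adj i j).
Proof.
apply: (iffP exists_inP) => [[g gG /existsP[b /andP[/eqP-> /eqP->]]]|[b [g [gG -> ->]]]].
  by exists b, g.
by exists g => //; apply/existsP; exists b; rewrite !eqxx.
Qed.

Lemma coset_adj_sym : symmetric coset_adj.
Proof.
have H i j : coset_adj i j -> coset_adj j i.
  by case/coset_adjP => b [g [gG -> ->]]; apply/coset_adjP; exists (~~ b), g; rewrite negbK.
by move=> i j; apply/idP/idP; exact: H.
Qed.

Lemma coset_adj_irr : irreflexive coset_adj.
Proof.
move=> i; apply/coset_adjP => -[b [g [gG -> /eqP]]].
by rewrite vx_eq //; case: b.
Qed.

Definition coset_graph := SGraph coset_adj_sym coset_adj_irr.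

(** The edges at the coset of [g] are the elements [g * u] with [u] in [U b]; by [TI_U] they lead to
    distinct cosets on the other side. *)
Lemma coset_graph_degree b g : g \in G -> degree coset_graph (vx b g) = #|U b|.
Proof.
move=> gG; have sU c u : u \in U c -> u \in G by apply/subsetP/sub_join_bool.
rewrite /degree -(card_in_imset (f := fun u => vx (~~ b) (g * u))) => [|u u' uU u'U /eqP].
  apply: eq_card => j; rewrite inE; apply/coset_adjP/imsetP => [[b' [h [hG /eqP]]]|[u uU ->]].
    rewrite vx_eq // => /andP[/eqP<- gh ->]; exists (g^-1 * h) => //.
    by rewrite mulKVg.
  by exists b, (g * u); split; [exact: groupM gG (sU _ _ uU)|rewrite vx_mulr|].
have guG c : c \in U b -> g * c \in G by move=> /sU; exact: groupM.
rewrite vx_eq ?guG // eqxx invMg -mulgA mulKg => uu'.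
suff : u^-1 * u' \in U false :&: U true.
  by rewrite TI_U => /set1P/(canRL (mulKVg _)); rewrite mulg1.
have : u^-1 * u' \in U b by rewrite groupM ?groupV.
by move: uu'; rewrite inE; case: (b) => /= -> ->.
Qed.

(** An element of the join is a product of letters from the two subgroups. Appending a letter of
    [U b] stays in the same coset of [U b], so each letter costs a short walk. *)
Lemma coset_graph_connected : connected coset_graph.
Proof.
have sU c u : u \in U c -> u \in G by apply/subsetP/sub_join_bool.
have adjv b g : g \in G -> connect coset_graph (vx b g) (vx (~~ b) g).
  by move=> gG; apply/connect1/coset_adjP; exists b, g.
have same b b' g : g \in G -> connect coset_graph (vx b g) (vx b' g).
  by case: b; case: b' => gG //; exact: adjv.
have step b g u : g \in G -> u \in U b ->
    connect coset_graph (vx false g) (vx false (g * u)).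
  move=> gG uU; apply: connect_trans (same false b g gG) _.
  by rewrite -(vx_mulr gG uU) same //; exact: groupM gG (sU _ _ uU).
have reach g : g \in G -> connect coset_graph (vx false 1) (vx false g).
  case/gen_prodgP => m [c cU ->].
  elim: m c cU => [|m IH] c cU; first by rewrite big_ord0 connect0.
  rewrite big_ord_recr /=; apply: connect_trans (IH _ (fun i => cU (widen_ord (leqnSn m) i))) _.
  have pG : \prod_(i < m) c (widen_ord (leqnSn m) i) \in G.
    by apply: group_prod => i _; have /setUP[] := cU (widen_ord (leqnSn m) i); exact: sU.
  by have /setUP[] := cU ord_max; exact: step.
have sym := sym_connect_sym coset_adj_sym.
move=> i j; have [b [g [gG ->]]] := vx_surj i; have [b' [h [hG ->]]] := vx_surj j.
apply: connect_trans (same b false g gG) _.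
apply: connect_trans (same false b' h hG); apply: connect_trans (reach h hG).
by rewrite sym reach.
Qed.

Definition translate h (i : 'I_ncosets) : 'I_ncosets :=
  enum_rank_in (coset_in false (group1 G)) ((enum_val i).1, h *: (enum_val i).2).

Lemma translate_vx h b g : g \in G -> translate h (vx b g) = vx b (h * g).
Proof. by move=> gG; rewrite /translate enum_val_vx //= /vx lcosetM. Qed.

Lemma translate_inj h : h \in G -> injective (translate h).
Proof.
move=> hG i j; have [b [g [gG ->]]] := vx_surj i; have [b' [g' [gG' ->]]] := vx_surj j.
have hgG k : k \in G -> h * k \in G by exact: groupM.
rewrite !translate_vx // => /eqP; rewrite vx_eq ?hgG // => E; apply/eqP.
by move: E; rewrite vx_eq // invMg -mulgA mulKg.
Qed.

Lemma translate_adj h i j : h \in G -> coset_adj (translate h i) (translate h j) = coset_adj i j.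
Proof.
have H k i' j' : k \in G -> coset_adj i' j' -> coset_adj (translate k i') (translate k j').
  move=> kG /coset_adjP[b [g [gG -> ->]]]; apply/coset_adjP; exists b, (k * g).
  by rewrite groupM // !translate_vx.
have K k : k \in G -> cancel (translate k) (translate k^-1).
  move=> kG i'; have [b [g [gG ->]]] := vx_surj i'.
  by rewrite !translate_vx ?groupM // mulKg.
move=> hG; apply/idP/idP; last exact: H.
by move=> /(H h^-1); rewrite groupV !K //; exact.
Qed.

(** Left translation by [g' * g^-1] is an automorphism carrying the edge of [g] to that of [g'];
    symmetry takes care of orientation. *)
Lemma coset_graph_eff_res (R : realType) (a b a' b' : 'I_ncosets) :
  coset_graph a b -> coset_graph a' b' ->
  eff_res R coset_graph a b = eff_res R coset_graph a' b'.
Proof.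
case/coset_adjP => c [g [gG -> ->]] /coset_adjP[c' [g' [gG' -> ->]]].
have hG : g' * g^-1 \in G by rewrite groupM ?groupV.
pose s := perm (translate_inj hG).
have sE d : s (vx d g) = vx d g' by rewrite permE translate_vx // mulgKV.
rewrite -(@eff_res_perm _ _ _ s) => [|i j]; last by rewrite !permE; exact: translate_adj.
by rewrite !sE; case: c; case: c'; rewrite // eff_res_sym.
Qed.

(** Reduced words of the free product of [U false] and [U true] with first letter on side [b]. *)
Fixpoint alternating b (s : seq gT) : bool :=
  if s is u :: s' then [&& u \in U b, u != 1 & alternating (~~ b) s'] else true.

(* A walk without leaves revisits an edge within [k] steps, and the steps between
   the two visits multiply to [1]. *)
Lemma coset_graph_leafy k :
  (forall b s, alternating b s -> (0 < size s <= k)%N -> \prod_(u <- s) u != 1) ->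
  leafy coset_graph k.
Proof.
move=> girth S S0 leSk; apply: contrapT => noleaf.
have /choice[el elP] : forall e : edge coset_graph, exists g,
    g \in G /\ edge_set e = [set vx false g; vx true g].
  move=> e; have [i [j [/coset_adjP[b [g [gG -> ->]]] ->]]] := edgeP e.
  by exists g; split=> //; case: b; rewrite // setUC.
have vx_el b e : vx b (el e) \in edge_set e.
  by rewrite (elP e).2; case: b; rewrite !inE eqxx ?orbT.
have vx_mem b g e : g \in G -> vx b g \in edge_set e -> g^-1 * el e \in U b.
  move=> gG; rewrite (elP e).2 !inE !vx_eq ?(elP e).1 //.
  by case: b => /=; rewrite ?orbF.
(* Without leaves, an edge of [S] can be left through its endpoint on either side, towards another
   edge of [S]. *)
have /choice[nx nxP] : forall p : bool * edge coset_graph, exists e', p.2 \in S ->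
    [/\ e' \in S, vx p.1 (el p.2) \in edge_set e' & e' != p.2].
  move=> [b e] /=; have [eS|] := boolP (e \in S); last by exists e.
  apply: contrapT => H; apply: noleaf; exists e, (vx b (el e)); split=> // e' e'S ve'.
  by apply/eqP; apply: contraT => ne; case: H; exists e'.
have [e0 e0S] := set0Pn _ S0.
(* The walk leaves its edge number [t] on side [odd t]. Consecutive edges share that vertex, so the
   quotient of their group elements is a nontrivial letter of [U (odd t)]. *)
pose st i := iteri i (fun t e => nx (odd t, e)) e0.
have stS i : st i \in S by elim: i => //= i IH; case: (nxP (odd i, st i) IH).
pose step t := (el (st t))^-1 * el (st t.+1).
have prod_step i m : \prod_(t <- iota i m) step t = (el (st i))^-1 * el (st (i + m)%N).
  elim: m i => [|m IH] i; first by rewrite big_nil addn0 mulVg.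
  by rewrite big_cons IH /step -mulgA mulKVg addnS addSn.
have alt_step i m : alternating (odd i) [seq step t | t <- iota i m].
  elim: m i => [//|m IH i]; have [_ v ne] := nxP (odd i, st i) (stS i).
  have sU : step i \in U (odd i) by apply: vx_mem => //; case: (elP (st i)).
  have s1 : step i != 1.
    apply: contraNneq ne => /(canRL (mulKVg _)); rewrite mulg1 => E.
    by apply/eqP/edge_set_inj; rewrite (elP _).2 [RHS](elP _).2 E.
  by rewrite [iota i m.+1]/= map_cons /= sU s1 (IH i.+1).
(* Pigeonhole: [k + 1] positions, at most [k] edges. *)
have : ~~ injectiveb (fun i : 'I_k.+1 => st i).
  apply/injectiveP => /card_codom H; move: leSk; rewrite leqNgt => /negP[].
  rewrite -[k.+1]card_ord -H; apply/subset_leq_card/subsetP => e /codomP[i ->].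
  exact: stS.
case/injectivePn => i [j ne E].
wlog ij : i j ne E / (i < j)%N.
  move=> H; case: (ltngtP i j) => [|ji|/val_inj ij]; first exact: H.
    by apply: (H j i); rewrite 1?eq_sym.
  by rewrite ij eqxx in ne.
have := girth _ _ (alt_step i (j - i)%N).
rewrite size_map size_iota subn_gt0 ij big_map prod_step subnKC ?(ltnW ij) // -E mulVg eqxx.
by rewrite (leq_trans (leq_subr i j) (leq_ord j)) => /(_ isT).
Qed.

End CosetGraph.

(** * Reduction to relations of even length *)

Section Alternating.
Local Open Scope group_scope.
Variables (gT : finGroupType) (U : bool -> {group gT}).

Lemma alternating_rcons b s x : alternating U b (rcons s x) =
  [&& alternating U b s, x \in U (b (+) odd (size s)) & x != 1].
Proof.
elim: s b => [|y s IH] b /=; first by rewrite addbF andbT.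
by rewrite IH addNb addbN -!andbA.
Qed.

(** The two products are conjugate. *)
Lemma prod_rcons1 (s : seq gT) x :
  (\prod_(u <- rcons s x) u == 1) = (\prod_(u <- x :: s) u == 1).
Proof.
rewrite -cats1 big_cat big_seq1 big_cons /=; set p := \prod_(u <- s) u.
by rewrite -(conjg_eq1 _ p) conjgE -mulgA mulKg.
Qed.

(* Cyclic rotation changes the starting side of a relation of even length; for odd
   length it merges the two end letters. *)
Lemma alternating_prod_neq1 K :
  (forall s, alternating U true s -> ~~ odd (size s) -> (0 < size s <= K)%N ->
     \prod_(u <- s) u != 1) ->
  forall b s, alternating U b s -> (0 < size s <= K)%N -> \prod_(u <- s) u != 1.
Proof.
move=> H; have even b s : alternating U b s -> ~~ odd (size s) ->
    (0 < size s <= K)%N -> \prod_(u <- s) u != 1.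
  case: b; first exact: H.
  case: s => // x s /= /and3P[xU x1 As]; rewrite negbK => os sK.
  rewrite -prod_rcons1; apply: H; rewrite ?size_rcons /= ?negbK //.
  by rewrite alternating_rcons As os x1 xU.
move=> b s; have [m] := ubnP (size s); elim: m b s => // m IH b s ltsm As sK.
have [os|es] := boolP (odd (size s)); last exact: even As es sK.
case: s As os sK ltsm => // x s /= /and3P[xU x1 As] os sK ltsm.
case/lastP: s As os sK ltsm => [|s y]; first by rewrite big_seq1.
rewrite alternating_rcons size_rcons /= negbK => /and3P[As yU y1] os sK ltsm.
rewrite os addbT negbK in yU.
rewrite -rcons_cons prod_rcons1 2!big_cons mulgA.
(* Both end letters lie on the same side. If they cancel, the inner word is a shorter word of odd
   length; otherwise merging them gives one of even length. *)
have [yx1|yx1] := eqVneq (y * x) 1.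
  by rewrite yx1 mul1g; apply: IH As _; [lia|case: (s) os sK => //= ? ?; lia].
have := even b (y * x :: s); rewrite big_cons; apply => /=.
- by rewrite groupM // yx1.
- by rewrite os.
- by lia.
Qed.

End Alternating.

(** * Alternating words in SL_2 *)

Section Mat2.
Variable A : comNzRingType.
Implicit Types M N : A * A * A * A.

Definition mul2 M N := let: (a, b, c, d) := M in let: (a', b', c', d') := N in
  (a * a' + b * c', a * b' + b * d', c * a' + d * c', c * b' + d * d').
Definition one2 : A * A * A * A := (1, 0, 0, 1).
Definition det2 M := let: (a, b, c, d) := M in a * d - b * c.
Definition adj2 M := let: (a, b, c, d) := M in (d, - b, - c, a).
Definition tr2 M := let: (a, b, c, d) := M in a + d.

Lemma mul2A : associative mul2.
Proof.
by move=> [[[a b] c] d] [[[a' b'] c'] d'] [[[a2 b2] c2] d2] /=; congr (_, _, _, _); ring.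
Qed.

Lemma mul12 : left_id one2 mul2.
Proof. by move=> [[[a b] c] d] /=; congr (_, _, _, _); ring. Qed.

Lemma det2M M N : det2 (mul2 M N) = det2 M * det2 N.
Proof. by case: M N => [[[a b] c] d] [[[a' b'] c'] d'] /=; ring. Qed.

Lemma det_adj2 M : det2 (adj2 M) = det2 M.
Proof. by case: M => [[[a b] c] d] /=; ring. Qed.

Lemma mul_adj2 M : det2 M = 1 -> mul2 (adj2 M) M = one2.
Proof.
by case: M => [[[a b] c] d] /= D; congr (_, _, _, _); rewrite -?D; ring.
Qed.

Lemma det_one2 : det2 one2 = 1. Proof. by rewrite /=; ring. Qed.

(** With [(b0, d0)] as base point, every completion is [(b0, d0) + t * (a, c)] where
    [t = d0 * b - b0 * d]. *)
Lemma det2_complete (a c b0 d0 b d b' d' : A) : a * d0 - b0 * c = 1 ->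
  a * d - b * c = 1 -> a * d' - b' * c = 1 ->
  d0 * b - b0 * d = d0 * b' - b0 * d' -> (b, d) = (b', d').
Proof.
move=> D0.
have bE x y : a * y - x * c = 1 -> x = a * (d0 * x - b0 * y) + b0.
  by move=> Dxy; rewrite -[LHS]mulr1 -[X in _ + X]mulr1 -{1}D0 -Dxy; ring.
have dE x y : a * y - x * c = 1 -> y = d0 + c * (d0 * x - b0 * y).
  by move=> Dxy; rewrite -[LHS]mulr1 -[X in X + _]mulr1 -{1}D0 -Dxy; ring.
move=> D D' E; congr (_, _); first by rewrite (bE b d D) E -(bE b' d' D').
by rewrite (dE b d D) E -(dE b' d' D').
Qed.

(** For a matrix [1 + h N] of determinant [1], expanding the determinant gives
    [h tr N = - h ^ 2 det N]. *)
Lemma tr2_congr_one (h a b c d : A) :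
  det2 (1 + a * h, b * h, c * h, 1 + d * h) = 1 ->
  (1 + a * h) + (1 + d * h) - 2 = (b * c - a * d) * h ^+ 2.
Proof.
move=> D; have -> : (1 + a * h) + (1 + d * h) - 2 =
    det2 (1 + a * h, b * h, c * h, 1 + d * h) - 1 + (b * c - a * d) * h ^+ 2.
  by rewrite /=; ring.
by rewrite D subrr add0r.
Qed.

End Mat2.

Definition map_mat2 (A B : comNzRingType) (f : A -> B) (M : A * A * A * A) :=
  let: (a, b, c, d) := M in (f a, f b, f c, f d).

Lemma map_mat2M (A B : comNzRingType) (f : {rmorphism A -> B}) M N :
  map_mat2 f (mul2 M N) = mul2 (map_mat2 f M) (map_mat2 f N).
Proof.
by case: M N => [[[a b] c] d] [[[a' b'] c'] d'] /=; rewrite !(rmorphD, rmorphM).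
Qed.

Lemma det2_map (A B : comNzRingType) (f : {rmorphism A -> B}) M :
  det2 (map_mat2 f M) = f (det2 M).
Proof. by case: M => [[[a b] c] d] /=; rewrite !(rmorphB, rmorphM). Qed.

(** * Degrees of alternating words over the polynomial ring *)

Section Words.
Variable F : fieldType.

Definition elem2 (b : bool) (x : F) : {poly F} * {poly F} * {poly F} * {poly F} :=
  if b then (1, x%:P, 0, 1) else (1, 0, x *: 'X, 1).

Lemma elem2D b x y : mul2 (elem2 b x) (elem2 b y) = elem2 b (x + y).
Proof.
case: b; rewrite /= ?(mulr0, mul0r, addr0, add0r, mul1r, mulr1).
  by rewrite polyCD [x%:P + _]addrC.
by rewrite scalerDl.
Qed.

Lemma det_elem2 b x : det2 (elem2 b x) = 1.
Proof. by case: b; rewrite /= ?mulr0 ?mul0r mulr1 subr0. Qed.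

Definition word2 (s : seq (F * F)) :=
  foldr (fun p M => mul2 (mul2 (elem2 true p.1) (elem2 false p.2)) M) (one2 _) s.

Lemma word2_cons p s :
  word2 (p :: s) = mul2 (mul2 (elem2 true p.1) (elem2 false p.2)) (word2 s).
Proof. by []. Qed.

Lemma det_word2 s : det2 (word2 s) = 1.
Proof.
by elim: s => [|p s IH]; rewrite ?det_one2 // word2_cons !det2M !det_elem2 IH !mulr1.
Qed.

Definition nz2 (p : F * F) := (p.1 != 0) && (p.2 != 0).

Lemma elem2_tf x y :
  mul2 (elem2 true x) (elem2 false y) = (1 + (x * y) *: 'X, x%:P, y *: 'X, 1).
Proof.
by rewrite /= !(mulr0, mul0r, addr0, add0r, mul1r, mulr1) mul_polyC scalerA.
Qed.

(** Every pair of letters raises the degree of the upper left entry by exactly one, and that entry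
    dominates. The [maxn] covers the empty word, where [d = 1]. *)
Lemma size_word2 s : all nz2 s -> let: (a, b, c, d) := word2 s in
  [/\ size a = (size s).+1, (size b <= size s)%N, (size c <= (size s).+1)%N &
      (size d <= maxn (size s) 1)%N].
Proof.
have D n (p q : {poly F}) : (size p <= n -> size q <= n -> size (p + q)%R <= n)%N.
  by move=> sp sq; rewrite (leq_trans (size_polyD p q)) // geq_max sp sq.
have Z n z (p : {poly F}) : (size p <= n -> size (z%:P * p)%R <= n)%N.
  by move=> sp; rewrite mul_polyC (leq_trans (size_scale_leq z p)).
have X n z (p : {poly F}) : (size p <= n -> size (z *: 'X * p)%R <= n.+1)%N.
  rewrite -scalerAl => sp; rewrite (leq_trans (size_scale_leq z _)) // mulrC.
  by have [->|p0] := eqVneq p 0; rewrite ?mul0r ?size_poly0 // size_mulX.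
elim: s => [_|[x y] s IH]; first by rewrite /= size_poly0 size_poly1.
rewrite word2_cons elem2_tf => /andP[/andP[x0 y0] /IH]; rewrite [_.1]/= [_.2]/= in x0 y0.
case: (word2 s) => [[[a b] c] d] [sa sb sc sd] /=; set l := size s in sa sb sc sd *.
have sd' : (size d <= l.+1)%N by apply: leq_trans sd _; rewrite geq_max leqnSn.
rewrite !mulrDl !mul1r; split.
(* The leading term comes from [(x * y) *: 'X * a], as [x * y] is nonzero. *)
- have s1 : size ((x * y) *: 'X * a) = l.+2.
    by rewrite -scalerAl size_scale ?mulf_neq0 // mulrC size_mulX -?size_poly_eq0 ?sa.
  by rewrite -addrA addrCA size_polyDl s1 // ltnS D ?Z // sa.
- by rewrite D ?Z // D ?X // (leq_trans sb).
- by rewrite D ?X ?sa // (leq_trans sc).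
- by rewrite D ?X ?(leq_trans _ (leq_maxl _ _)) //.
Qed.

Lemma size_tr2_word2 s : all nz2 s -> (0 < size s)%N ->
  size (tr2 (word2 s) - 2) = (size s).+1.
Proof.
move=> /size_word2; case: (word2 s) => [[[a b] c] d] [sa _ _ sd] s0 /=.
rewrite -addrA size_polyDl // sa ltnS (leq_trans (size_polyD _ _)) // geq_max size_polyN.
rewrite (leq_trans sd) ?geq_max ?s0 ?leqnn //=.
by rewrite -polyC_natr (leq_trans (size_polyC_leq1 _)).
Qed.

End Words.

(** * The finite quotient group and its two unipotent subgroups *)

Section SL2.
Variables (F : finFieldType) (h : {poly F}).
Local Notation A := {poly %/ h}.

Definition sl2 := {M : A * A * A * A | det2 M == 1}.
HB.instance Definition _ := Finite.on sl2.

Lemma sl2P (M : sl2) : det2 (val M) = 1. Proof. exact/eqP/(valP M). Qed.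

Lemma sl2_mul_subproof (M N : sl2) : det2 (mul2 (val M) (val N)) == 1.
Proof. by rewrite det2M !sl2P mulr1. Qed.

Lemma sl2_one_subproof : det2 (one2 A) == 1. Proof. by rewrite det_one2. Qed.

Lemma sl2_inv_subproof (M : sl2) : det2 (adj2 (val M)) == 1.
Proof. by rewrite det_adj2 sl2P. Qed.

Definition sl2_mul M N : sl2 := Sub (mul2 (val M) (val N)) (sl2_mul_subproof M N).
Definition sl2_one : sl2 := Sub (one2 A) sl2_one_subproof.
Definition sl2_inv M : sl2 := Sub (adj2 (val M)) (sl2_inv_subproof M).

Lemma sl2_mulA : associative sl2_mul.
Proof. by move=> M N P; apply: val_inj; exact: mul2A. Qed.

Lemma sl2_mul1 : left_id sl2_one sl2_mul.
Proof. by move=> M; apply: val_inj; exact: mul12. Qed.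

Lemma sl2_mulV : left_inverse sl2_one sl2_inv sl2_mul.
Proof. by move=> M; apply: val_inj; exact/mul_adj2/sl2P. Qed.

HB.instance Definition _ := Finite_isGroup.Build sl2 sl2_mulA sl2_mul1 sl2_mulV.

(* The completions of a first column [(a, c)] form a coset of the line through it,
   so one further coordinate determines the matrix. *)
Lemma card_sl2 : (#|{: sl2}| <= #|{: A}| ^ 3)%N.
Proof.
(* A chosen completion of each column; the default is never met, since [M] itself completes its
   first column. *)
pose base (p : A * A) := odflt (0, 0) [pick r : A * A | p.1 * r.2 - r.1 * p.2 == 1].
pose f (M : sl2) : A * A * A := let: (a, b, c, d) := val M in
  (a, c, (base (a, c)).2 * b - (base (a, c)).1 * d).
have inj : injective f.
  move=> M N; rewrite /f; have := sl2P M; have := sl2P N.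
  case E : (val M) => [[[a b] c] d]; case E' : (val N) => [[[a' b'] c'] d'].
  rewrite /det2 => DN DM /eqP; rewrite !xpair_eqE.
  case/andP => /andP[/eqP Ea /eqP Ec] /eqP; subst a' c' => Es.
  have D0 : a * (base (a, c)).2 - (base (a, c)).1 * c = 1.
    rewrite /base; case: pickP => [r /eqP //|/(_ (b, d))].
    by rewrite DM eqxx.
  by apply: val_inj; rewrite E E'; have [-> ->] := det2_complete D0 DM DN Es.
by rewrite (leq_trans (leq_card f inj)) // !card_prod !expnS muln1 mulnA.
Qed.

Hypotheses (h_monic : h \is monic) (h_size : (2 < size h)%N).

Lemma in_qpoly_eq (p q : {poly F}) : in_qpoly h p = in_qpoly h q ->
  exists r, p = q + r * h.
Proof.
(* The quotient is taken by [mk_monic h], which agrees with [h] for monic [h] of positive degree. *)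
have mkE : mk_monic h = h by rewrite /mk_monic h_monic (ltnW h_size).
move=> /(congr1 val) /=; rewrite mkE => E; exists (Pdiv.Ring.rdivp (p - q) h).
have := Pdiv.RingMonic.rdivp_eq h_monic (p - q).
rewrite Pdiv.RingMonic.rmodpB // E subrr addr0 => <-.
by rewrite addrC subrK.
Qed.

Lemma in_qpoly_eq0 (p : {poly F}) : (size p < size h)%N -> in_qpoly h p = 0 -> p = 0.
Proof.
move=> sp; rewrite -(in_qpoly0 h) => /in_qpoly_eq[r]; rewrite add0r => E.
apply: contraTeq sp => p0; rewrite -leqNgt E.
have r0 : r != 0 by apply: contra_neq p0 => r0; rewrite E r0 mul0r.
rewrite size_mul // ?(monic_neq0 h_monic) //; move: r0; rewrite -size_poly_gt0.
by case: (size r) => // l _; rewrite addSn leq_addl.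
Qed.

Lemma uni_subproof b (x : F) : det2 (map_mat2 (in_qpoly h) (elem2 b x)) == 1.
Proof. by rewrite det2_map det_elem2 rmorph1. Qed.

Definition uni b x : sl2 := Sub (map_mat2 (in_qpoly h) (elem2 b x)) (uni_subproof b x).

Lemma val_sl2M (M N : sl2) : val (M * N)%g = mul2 (val M) (val N).
Proof. by []. Qed.

Lemma uniD b : {morph uni b : x y / x + y >-> (x * y)%g}.
Proof.
by move=> x y; apply: val_inj; rewrite val_sl2M !SubK -map_mat2M elem2D.
Qed.

Lemma uni0 b : uni b 0 = 1%g.
Proof. by apply: (mulgI (uni b 0)); rewrite -uniD addr0 mulg1. Qed.

Lemma uni_set_group b : group_set [set uni b x | x : F].
Proof.
apply/group_setP; split=> [|_ _ /imsetP[x _ ->] /imsetP[y _ ->]].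
  by apply/imsetP; exists 0; rewrite ?uni0.
by apply/imsetP; exists (x + y); rewrite ?uniD.
Qed.

Canonical uni_group b : {group sl2} := Group (uni_set_group b).

(** Compare off-diagonal entries: constants and multiples of ['X] have degree below that of [h].
    This gives both the injectivity of [uni b] and the trivial intersection. *)
Lemma uni_cross b x y : uni b x = uni (~~ b) y -> x = 0.
Proof.
move=> /(congr1 val); rewrite !SubK.
have X0 : in_qpoly h (x *: 'X) = in_qpoly h 0 -> x = 0.
  have sX : (size (x *: 'X) < size h)%N.
    by rewrite (leq_ltn_trans (size_scale_leq _ _)) ?size_polyX.
  rewrite in_qpoly0 => /(in_qpoly_eq0 sX)/eqP.
  by rewrite scaler_eq0 polyX_eq0 orbF => /eqP.
have C0 : in_qpoly h x%:P = in_qpoly h 0 -> x = 0.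
  have sC : (size x%:P < size h)%N by rewrite (leq_ltn_trans (size_polyC_leq1 _)) // ltnW.
  by rewrite in_qpoly0 => /(in_qpoly_eq0 sC)/eqP; rewrite polyC_eq0 => /eqP.
rewrite /elem2 /map_mat2; case: b => /eqP; rewrite !xpair_eqE.
  by case/andP => /andP[/andP[_ /eqP/C0]].
by case/andP => /andP[_ /eqP/X0].
Qed.

Lemma uni_inj b : injective (uni b).
Proof.
move=> x y E; apply/eqP; rewrite -subr_eq0; apply/eqP/(@uni_cross b _ 0).
by rewrite uniD E -uniD subrr !uni0.
Qed.

Lemma card_uni b : #|uni_group b| = #|F|.
Proof. by rewrite card_imset //; exact: uni_inj. Qed.

Lemma uni_TI : uni_group false :&: uni_group true = 1%g.
Proof.
apply/trivgP/subsetP => _ /setIP[/imsetP[x _ ->] /imsetP[y _ /uni_cross ->]].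
by rewrite uni0 inE.
Qed.

Lemma alternating_uni_even s : alternating uni_group true s -> ~~ odd (size s) ->
  exists t, [/\ all (@nz2 F) t, size s = (size t).*2 &
    val (\prod_(u <- s) u)%g = map_mat2 (in_qpoly h) (word2 t)].
Proof.
have [m] := ubnP (size s); elim: m s => // m IH [|u [|v s]] // ltm.
  by exists [::]; split=> //; rewrite big_nil /= rmorph0 rmorph1.
move=> /and3P[/imsetP[x _ ->] x0 /and3P[/imsetP[y _ ->] y0 As]] /=; rewrite negbK => es.
have [|t [nzt st vt]] := IH s _ As es; first exact: ltnW.
have nz b z : uni b z != 1%g -> z != 0 by apply: contra_neq => ->; exact: uni0.
exists ((x, y) :: t); split.
- by rewrite /= nzt /nz2 (nz _ _ x0) (nz _ _ y0).
- by rewrite /= st doubleS.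
- by rewrite !big_cons mulgA !val_sl2M vt word2_cons !map_mat2M.
Qed.

Lemma uni_girth b s : alternating uni_group b s ->
  (0 < size s <= ((size h).-1 * 4).-1)%N -> (\prod_(u <- s) u)%g != 1%g.
Proof.
apply: alternating_prod_neq1 => {}s /alternating_uni_even As /As[t [nzt st vt]] sK.
apply/negP => /eqP p1; move: vt; rewrite p1.
have t0 : (0 < size t)%N by rewrite st double_gt0 in sK; case/andP: sK.
have := size_tr2_word2 nzt t0; have := det_word2 t.
case: (word2 t) => [[[a b'] c] d] det1 str /eqP; rewrite /map_mat2 !xpair_eqE.
rewrite -(rmorph1 (in_qpoly h)) -(rmorph0 (in_qpoly h)).
case/andP => /andP[/andP[/eqP/esym/in_qpoly_eq[ra Ea] /eqP/esym/in_qpoly_eq[rb Eb]]].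
move=> /eqP/esym/in_qpoly_eq[rc Ec] /eqP/esym/in_qpoly_eq[rd Ed].
rewrite add0r in Eb; rewrite add0r in Ec; subst a b' c d.
(* The trace minus [2] is [e * h ^ 2] with [e] nonzero, so its degree [size t] is at least
   [2 * (size h).-1]. Then [size s] is at least [4 * (size h).-1], one more than allowed. *)
move: str; rewrite /tr2 (tr2_congr_one det1); set e := (X in X * _) => se.
have e0 : e != 0 by apply: contra_eq_neq se => ->; rewrite mul0r size_poly0.
have h0 : h != 0 by rewrite monic_neq0.
move: se; rewrite size_mul ?expf_neq0 // expr2 size_mul //.
have : (0 < size e)%N by rewrite size_poly_gt0.
move: sK h_size; rewrite st -muln2 => /andP[_].
by move: (size h) (size e) (size t) => u v l *; lia.
Qed.

End SL2.

Lemma ex_dense_large_girth_graph (R : realType) (F : finFieldType) (m : nat) : (1 < m)%N ->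
  exists n (G : sgraph n),
    [/\ connected G, forall v, degree G v = #|F|,
        forall a b a' b', G a b -> G a' b' -> eff_res R G a b = eff_res R G a' b',
        leafy G (m * 4).-1 & (#|F| <= n <= 2 * #|F| ^ (3 * m - 1))%N].
Proof.
move=> m1; pose h : {poly F} := 'X^m.
have hm : h \is monic by exact: monicXn.
have sh : size h = m.+1 by exact: size_polyXn.
have h2 : (2 < size h)%N by rewrite sh ltnS.
pose U := uni_group h; have TI : U false :&: U true = 1%g := uni_TI hm h2.
have cU b : #|U b| = #|F| := card_uni hm h2 b.
have deg v : degree (coset_graph U) v = #|F|.
  by have [b [g [gG ->]]] := vx_surj v; rewrite coset_graph_degree.
exists (ncosets U), (coset_graph U); split=> //.
- exact: coset_graph_connected.
- exact: coset_graph_eff_res.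
- by apply: coset_graph_leafy => b s /(uni_girth hm h2); rewrite sh; exact.
have F0 : (0 < #|F|)%N by apply/card_gt0P; exists 0.
apply/andP; split.
  rewrite -(deg (vx U false 1%g)) /degree (leq_trans (max_card _)) //.
  by rewrite card_ord.
(* With [q = #|F|], the quotient ring has [q ^ m] elements, so [n * q] is at most
   [2 * q ^ (3 * m)]. *)
rewrite -(leq_pmul2r F0) (ncosets_card cU) -mulnA leq_mul2l /= -expnSr.
rewrite (leq_trans (max_card _)) // (leq_trans (card_sl2 _)) //.
rewrite (card_monic_qpoly (ltnW h2) hm) sh -expnM leq_exp2l //; last exact: card_finNzRing_gt1.
by clear -m1; lia.
Qed.

(** * Choice of the parameters *)

Section Numeric.
Variable R : realType.
Implicit Types c alpha x : R.

(** The tangent bound [ln t <= t - 1] at [t = delta * x]; it serves to absorb the iterated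
    logarithm. *)
Lemma ln_le_affine (delta x : R) : 0 < delta -> 0 < x -> ln x <= delta * x - ln delta.
Proof.
move=> d0 x0; rewrite lerBrDr addrC -lnM ?posrE //.
have dx : 0 < delta * x by rewrite mulr_gt0.
apply: le_trans (_ : delta * x - 1 <= _); last by lra.
by rewrite -{1}(subrKC 1 (delta * x)); apply: le_ln1Dx; lra.
Qed.

Lemma ex_exponent c alpha (E N : nat) : 0 < c -> 0 < alpha -> 2 * alpha < 1 ->
  E%:R * alpha <= 1 + 2 * alpha ->
  exists2 p, prime p & (N < p)%N /\
    forall n : nat, (p <= n <= 2 * p ^ E)%N -> exists alpha0 : R,
      (1 - 2 * alpha) * alpha <= alpha0 /\
      p%:R / 2 = c * ln n%:R * (n%:R `^ alpha0).
Proof.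
move=> c0 al0 al1 Eal.
(* The hypothesis on [E] yields [beta * E <= 1 - 2 * delta]. One [delta * ln p] of this slack pays
   for [ln (ln p)], the other for the constants collected in [K]; the choice of [M] makes [p] large
   enough for the latter. *)
pose beta := (1 - 2 * alpha) * alpha; pose delta := 2 * alpha ^+ 2.
have b0 : 0 < beta by rewrite mulr_gt0 // subr_gt0.
have d0 : 0 < delta by rewrite mulr_gt0 ?exprn_gt0.
pose K := beta * ln 2 + ln (2 * c) + ln E.+1%:R - ln delta.
pose M := expR (K / delta).
have [p ltp pp] := prime_above (maxn N (Num.truncn M)).
exists p => //; split; first exact: leq_ltn_trans (leq_maxl _ _) ltp.
move=> n /andP[pn np].
have p2 : (1 < p)%N := prime_gt1 pp; have n2 : (1 < n)%N := leq_trans p2 pn.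
have pR : 0 < p%:R :> R by rewrite ltr0n prime_gt0.
have nR : 0 < n%:R :> R by rewrite ltr0n ltnW.
have n1 : 1 < n%:R :> R by rewrite ltr1n.
set y : R := ln n%:R; set x : R := ln p%:R.
have y0 : 0 < y by rewrite ln_gt0.
have x0 : 0 < x by rewrite ln_gt0 // ltr1n.
have Kx : K <= delta * x.
  rewrite mulrC -ler_pdivrMr // -[X in X <= _]expRK ler_ln ?posrE ?expR_gt0 //.
  apply: ltW; apply: lt_le_trans (truncnS_gt _) _; rewrite ler_nat.
  exact: leq_ltn_trans (leq_maxr _ _) ltp.
have two : 0 < ln 2 :> R by rewrite ln_gt0 // ltr1n.
have yx : y <= ln 2 + E%:R * x.
  rewrite mulr_natl -lnXn // -lnM ?posrE ?exprn_gt0 // ler_ln ?posrE ?mulr_gt0 ?exprn_gt0 //.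
  by rewrite -natrX -natrM ler_nat.
have l2x : ln 2 <= x by rewrite ler_ln ?posrE // ler_nat.
have lny : ln y <= ln E.+1%:R + ln x.
  rewrite -lnM ?posrE ?ltr0n // ler_ln ?posrE ?mulr_gt0 ?ltr0n //.
  by apply: le_trans yx _; rewrite -(natr1 E) mulrDl mul1r addrC lerD2l.
have lnx := ln_le_affine d0 x0.
(* The solution of the required equation after taking logarithms. *)
exists ((x - ln (2 * c) - ln y) / y); split.
  rewrite ler_pdivlMr // -/beta.
  have bE : beta * E%:R <= 1 - 2 * delta.
    have -> : 1 - 2 * delta = (1 - 2 * alpha) * (1 + 2 * alpha) by rewrite /delta; ring.
    by rewrite /beta -mulrA ler_pM2l ?subr_gt0 // mulrC.
  have by_ : beta * y <= beta * ln 2 + (1 - 2 * delta) * x.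
    apply: le_trans (ler_wpM2l (ltW b0) yx) _.
    by rewrite mulrDr lerD2l mulrA ler_wpM2r // ltW.
  move: Kx; rewrite /K; lra.
apply: ln_inj; rewrite ?posrE ?divr_gt0 ?mulr_gt0 ?powR_gt0 //.
rewrite ln_div ?posrE // !lnM ?posrE ?mulr_gt0 ?powR_gt0 // ln_powR -/x -/y.
by rewrite divfK ?gt_eqF //; lra.
Qed.
End Numeric.

Lemma leafyW n (G : sgraph n) k k' : (k <= k')%N -> leafy G k' -> leafy G k.
Proof. by move=> kk lk S S0 Sk; apply: lk => //; exact: leq_trans kk. Qed.

Theorem theorem4p1 (R : realType) (c alpha : R)
    (hc : 0 < c) (halpha : 0 < alpha <= 4 / 15) :
  forall N : nat, exists n : nat, (N < n)%N /\
  exists (G : sgraph n) (D : dist R {ffun edge G -> bool}),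
    [/\ connected G, regular G &
        forall a b a' b', G a b -> G a' b' ->
          eff_res R G a b = eff_res R G a' b'] /\
    kwise_indep (Num.truncn (4 / (3 * alpha))) (fun=> 1 / 2) D /\
    (exists alpha0 : R, (1 - 2 * alpha) * alpha <= alpha0 /\
       forall v : 'I_n,
         Ex D (fun x => (degree (sample x) v)%:R) =
         c * ln n%:R * (n%:R `^ alpha0)) /\
    1 - 2 ^ (1 - n%:Z) <= Pr D (fun x => ~ connected (sample x)) /\
    (forall (w : {ffun edge G -> bool} -> edge G -> R),
       (forall (x : {ffun edge G -> bool}) (e : edge G), x e -> 0 <= w x e) ->
       forall eps : R, 0 < eps < 1 ->
         1 - 2 ^ (1 - n%:Z) <=
         Pr D (fun x => ~ spectral_approx eps
                            (laplacian (sample_adjmx x (w x)))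
                            (laplacian (adjmx R G)))).
Proof.
move=> N; case/andP: halpha => al0 al1.
(* The least [m] with [k <= 4 * m - 1]. *)
set k := Num.truncn _; pose m := (k %/ 4).+1.
have al3 : 0 < 3 * alpha by lra.
have q0 : 0 <= 4 / (3 * alpha) by rewrite divr_ge0 // ltW.
have kal : k%:R * (3 * alpha) <= 4 by rewrite -ler_pdivlMr // truncn_le.
(* Here [alpha <= 4 / 15] enters: it makes [4 / (3 * alpha)] at least [5], hence [m] at least
   [2]. *)
have k5 : (5 <= k)%N by rewrite truncn_ge_nat // ler_pdivlMr //; lra.
have m1 : (1 < m)%N by rewrite ltnS divn_gt0 // ltnW.
have Eal : (3 * m - 1)%:R * alpha <= 1 + 2 * alpha.
  have -> : (3 * m - 1 = 3 * (k %/ 4) + 2)%N by rewrite /m; lia.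
  have : (k %/ 4)%:R * 4 <= k%:R :> R by rewrite -natrM ler_nat leq_trunc_div.
  rewrite natrD natrM; move: kal al0; nra.
have al2 : 2 * alpha < 1 by lra.
have [p pp [Np exp]] := ex_exponent N hc al0 al2 Eal.
have [n [G [cG]]] := ex_dense_large_girth_graph R 'F_p m1.
rewrite card_Fp // => deg res leaf nbound.
have lk : leafy G k by apply: leafyW leaf; rewrite /m; lia.
have n0 : (N < n)%N by case/andP: nbound => pn _; exact: leq_trans pn.
exists n; split=> //; exists G, (mono_dist R G); split; first by split=> //; exists p.
split; first exact: mono_kwise.
split.
  have [alpha0 [al0P E]] := exp n nbound; exists alpha0; split=> // v.
  by rewrite (mono_degree R v lk) ?deg // (leq_trans _ k5).
have n_gt0 : (0 < n)%N by exact: leq_ltn_trans n0.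
split.
  (* Sampled edges are monochromatic, so a connected sample has a single colour. *)
  apply: Pr_mono_ge => // y /contrapT cy; apply: (connected_const cy) => a b.
  exact: mono_sample.
move=> w _ eps /andP[_ eps1]; apply: Pr_mono_ge => // y /contrapT.
exact: mono_not_spectral_approx.
Qed.
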